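(* Let $\varepsilon>0$, $\delta\in(0,1)$, $T\in\mathbb{R}$, and let $\{f_i\}_{i\in\mathbb{N}}$ be real-valued queries on datasets that are each 1-sensitive (i.e. $|f_i(D)-f_i(D')|\le 1$ for neighboring $D,D'$) and have unidirectional sensitivity: for all neighboring datasets $D,D'$, if $f_i(D)>f_i(D')$ for some $i$, then there is no $j$ with $f_j(D)<f_j(D')$. Let $q$ be the $\left(1-\frac{\delta}{2(1+e^{\varepsilon})}\right)$-quantile of $\mathrm{Lap}(2/\varepsilon)$. Consider StrictUDSAboveThreshold: on input $D$, sample $\hat T\gets T+\mathrm{Lap}(2/\varepsilon)-2q$; then for $i=1,2,\dots$, sample a fresh $\nu_i\sim\mathrm{Lap}(2/\varepsilon)$; if $f_i(D)\ge T$ or $f_i(D)+\nu_i\ge\hat T$, output $a_i=\top$ and halt; otherwise output $a_i=\bot$ and continue. Then StrictUDSAboveThreshold (whose output is the stream $a_1,a_2,\dots$) is $(\varepsilon,\delta)$-differentially private.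
   Context: $\mathrm{Lap}(b)$ is the Laplace distribution with mean $0$ and scale $b$, density $\frac{1}{2b}e^{-|x|/b}$; all Laplace samples are independent. The $\phi$-quantile of a distribution is the value $x$ with $\Pr[X\le x]=\phi$. Two datasets are neighboring if they differ by replacing the contribution of one individual. A randomized algorithm $M$ is $(\varepsilon,\delta)$-differentially private if for every pair of neighboring datasets $D,D'$ and every set of outcomes $S$, $\Pr[M(D)\in S]\le e^{\varepsilon}\Pr[M(D')\in S]+\delta$ and symmetrically with $D,D'$ swapped. *)

(* Defs.v *)
From HB Require Import structures.
From mathcomp Require Import all_boot all_order all_algebra.
From mathcomp Require Import all_classical all_reals all_analysis.
Set Implicit Arguments. Unset Strict Implicit. Unset Printing Implicit Defensive.
Import Order.TTheory GRing.Theory Num.Theory.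
Local Open Scope classical_set_scope.
Local Open Scope ring_scope.

Section Defs.
Context {R : realType}.

Definition lap_pdf (b x : R) : R := (2 * b)^-1 * expR (- `|x| / b).

Definition is_laplace_rv {d} {T : measurableType d} (P : probability T R)
  (b : R) (Y : T -> R) : Prop :=
  measurable_fun setT Y /\
  forall A : set R, measurable A ->
    P (Y @^-1` A) = (\int[lebesgue_measure]_(x in A) (lap_pdf b x)%:E)%E.

Definition is_laplace_quantile (b phi q : R) : Prop :=
  (\int[lebesgue_measure]_(x in `]-oo, q]) (lap_pdf b x)%:E)%E = phi%:E.

Definition mutually_independent {d} {T : measurableType d} {I : eqType}
  (P : probability T R) (Y : I -> T -> R) : Prop :=
  forall (J : seq I) (A : I -> set R), uniq J ->
    (forall i, i \in J -> measurable (A i)) ->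
    P (\big[setI/setT]_(i <- J) (Y i @^-1` A i)) =
    (\prod_(i <- J) P (Y i @^-1` A i))%E.

End Defs.

(* Datasets are finite sequences of individuals' contributions; two datasets
   are neighboring if they differ by replacing the contribution of one
   individual. *)
Definition neighboring {X : Type} (D D' : seq X) : Prop :=
  exists (s1 s2 : seq X) (x y : X), D = s1 ++ x :: s2 /\ D' = s1 ++ y :: s2.

Section Mech.
Context {R : realType} {X : Type} {d} {T : measurableType d}.

(* StrictUDSAboveThreshold.  Queries are f 0, f 1, f 2, ... (the paper's
   f_1, f_2, ...), the threshold noise is Z, and the fresh noise for query k
   is nu k.  The run halts (outputs top) at step k iff k is the first index
   with f k D >= Thr or f k D + nu k w >= That w, where
   That w = Thr + Z w - 2 q. *)
Definition sudsat_stops (f : nat -> seq X -> R) (Thr q : R) (Z : T -> R)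
  (nu : nat -> T -> R) (D : seq X) (w : T) (k : nat) : bool :=
  `[< Thr <= f k D \/ Thr + Z w - 2 * q <= f k D + nu k w >].

(* The output stream a_1, a_2, ... is encoded by its halting index:
   Some k  <->  bot^k top (halt after answering top to query k),
   None    <->  bot forever. *)
Definition sudsat_output (f : nat -> seq X -> R) (Thr q : R) (Z : T -> R)
  (nu : nat -> T -> R) (D : seq X) (w : T) : option nat :=
  match pselect (exists k, sudsat_stops f Thr q Z nu D w k) with
  | left H => Some (ex_minn H)
  | right _ => None
  end.

End Mech.

Definition diff_private {R : realType} {X O : Type} {d} {T : measurableType d}
  (P : probability T R) (M : seq X -> T -> O) (eps delta : R) : Prop :=
  forall D D' : seq X, neighboring D D' ->
  forall S : set O,
    (P (M D @^-1` S) <= (expR eps)%:E * P (M D' @^-1` S) + delta%:E)%E /\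
    (P (M D' @^-1` S) <= (expR eps)%:E * P (M D @^-1` S) + delta%:E)%E.

(* Main.v *)
Require Import Defs.
From HB Require Import structures.
From mathcomp Require Import all_boot all_order all_algebra.
From mathcomp Require Import all_classical all_reals all_analysis.
From mathcomp Require Import measurable_realfun.
From mathcomp Require Import zify ring lra.
Import Order.TTheory GRing.Theory Num.Theory.
Local Open Scope classical_set_scope.
Local Open Scope ring_scope.

(** Write [c_i = T - 2 q - f_i(D)], so that query [i] halts on its noise iff
    [nu_i >= Z + c_i].  Since the queries move in one direction, the offsets [c]
    and [c'] of neighboring datasets satisfy [c_i <= c'_i + s <= c_i + 1] with
    [s = 0] or [s = 1].  Translating [Z] by [s] and [nu_k] by at most [1] turns a
    run halting at [k] on [D] into one halting at [k] on [D'], and each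
    translation costs a factor [exp(eps/2)].  To use independence only on
    rectangles, [Z] is first localized in the cells of a grid of mesh [h]; the
    translations then have lengths [s + h] and at most [1 + 2 h], and [h] tends
    to [0].

    The forced halts matter only from the first index [K] at which [f_K(D)] or
    [f_K(D')] reaches [T].  A run surviving [K] without halting on its noise
    requires, on the dataset reaching [T], that [nu_K < Z - 2 q], hence [Z > q]
    or [nu_K < - q]; this has probability at most [delta / (1 + exp(eps))], and
    transferring it to the other dataset costs a factor [exp(eps)]. *)

(** * Changes of variables for Lebesgue measure *)

(** The pushforward of Lebesgue measure along [phi] agrees with it on half-open intervals, hence on
    all measurable sets by uniqueness. Translations and the reflection are the two instances. *)
Lemma ge0_lebesgue_integral_preserving (R : realType)
  (phi : measurableTypeR R -> measurableTypeR R) (f : measurableTypeR R -> R)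
  (A : set (measurableTypeR R)) :
  measurable_fun setT phi ->
  (forall a b : R, lebesgue_measure (phi @^-1` `]a, b]) =
                   lebesgue_measure `]a, b]) ->
  measurable A -> measurable_fun A f -> (forall x, 0 <= f x) ->
  (\int[lebesgue_measure]_(x in A) (f x)%:E =
   \int[lebesgue_measure]_(x in phi @^-1` A) (f (phi x))%:E)%E.
Proof.
move=> mphi phiP mA mf f0.
pose phi' : {mfun _ >-> _} := HB.pack phi (isMeasurableFun.Build _ _ _ _ _ mphi).
transitivity (\int[pushforward lebesgue_measure phi]_(x in A) (f x)%:E)%E;
  last first.
  apply: (ge0_integral_pushforward mphi lebesgue_measure (f := EFin \o f)) => //.
  - exact/measurable_EFinP.
  - by move=> x _; rewrite lee_fin.
apply: eq_measure_integral => B mB _.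
apply: (@lebesgue_measure_unique _ (pushforward lebesgue_measure phi')) => //.
by move=> _ [[a b] _ <-]; exact/esym/phiP.
Qed.

Lemma ge0_lebesgue_integral_shift (R : realType) (f : R -> R) (A : set R)
  (t : R) : measurable A -> measurable_fun A f -> (forall x, 0 <= f x) ->
  (\int[lebesgue_measure]_(x in A) (f x)%:E =
   \int[lebesgue_measure]_(x in [set x | A (x + t)%R]) (f (x + t)%R)%:E)%E.
Proof.
apply: (@ge0_lebesgue_integral_preserving _ (fun x => x + t)).
  by apply: measurable_funD => //; exact: measurable_cst.
move=> a b; rewrite (_ : _ @^-1` _ = [set` `]a - t, b - t]]); last first.
  by apply/seteqP; split => x /=; rewrite !in_itv/=; lra.
rewrite !lebesgue_measure_itv/= !lte_fin ltrD2r; case: ifP => // _.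
by rewrite -!EFinB; congr EFin; lra.
Qed.

Lemma ge0_lebesgue_integral_opp (R : realType) (f : R -> R) (A : set R) :
  measurable A -> measurable_fun A f -> (forall x, 0 <= f x) ->
  (\int[lebesgue_measure]_(x in A) (f x)%:E =
   \int[lebesgue_measure]_(x in [set x | A (- x)%R]) (f (- x)%R)%:E)%E.
Proof.
apply: (@ge0_lebesgue_integral_preserving _ -%R).
  exact: oppr_measurable.
move=> a b; rewrite (_ : _ @^-1` _ = [set` `[- b, - a[]); last first.
  by apply/seteqP; split => x /=; rewrite !in_itv/=; lra.
rewrite !lebesgue_measure_itv/= !lte_fin ltrN2; case: ifP => // _.
by rewrite -!EFinB; congr EFin; lra.
Qed.

(** * Laplace noise: density, translations and tails *)

Lemma measurable_lap_pdf (R : realType) (b : R) : measurable_fun setT (lap_pdf b).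
Proof.
apply: measurable_funM => //; apply: measurableT_comp => //.
by apply: measurable_funM => //; apply: measurable_funN; exact: normr_measurable.
Qed.

Lemma lap_pdf_ge0 (R : realType) (b x : R) : 0 < b -> 0 <= lap_pdf b x.
Proof. by move=> b0; rewrite mulr_ge0 ?expR_ge0// invr_ge0; lra. Qed.

(** This is [|x + t| <= |x| + |t|] in the exponent. Integrated over an event, it becomes the cost of
    translating one noise variable. *)
Lemma lap_pdf_shift (R : realType) (b x t : R) : 0 < b ->
  lap_pdf b x <= expR (`|t| / b) * lap_pdf b (x + t).
Proof.
move=> b0; rewrite /lap_pdf mulrCA ler_wpM2l ?invr_ge0//; first by lra.
rewrite -expRD ler_expR -mulrDl ler_pM2r ?invr_gt0//.
by have := lerB_dist (x + t) t; rewrite addrK; have := ler_normB (x + t) t; rewrite addrK; lra.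
Qed.

Section laplace_rv.
Context {R : realType} {d : measure_display} {T : measurableType d}.
Variables (P : probability T R) (b : R) (Y : T -> R).
Hypotheses (b0 : 0 < b) (lapY : is_laplace_rv P b Y).

Let mpdf (A : set R) : measurable_fun A (fun x => (lap_pdf b x)%:E).
Proof.
by apply/measurable_EFinP; apply: measurable_funTS; exact: measurable_lap_pdf.
Qed.

Lemma laplace_rv_measurable (A : set R) : measurable A -> measurable (Y @^-1` A).
Proof. by move=> mA; rewrite -[_ @^-1` _]setTI; have [mY _] := lapY; exact: mY. Qed.

Lemma laplace_rv_shift (A : set R) (t : R) : measurable A ->
  (P (Y @^-1` [set x | A (x + t)%R]) <=
   (expR (`|t| / b))%:E * P (Y @^-1` A))%E.
Proof.
move=> mA.
have mAt : measurable [set x | A (x + t)%R].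
  rewrite -[X in measurable X]setTI.
  by apply: (@measurable_funD _ _ _ setT id (cst t)).
rewrite !lapY.2// (@ge0_lebesgue_integral_shift _ _ A t)//; first last.
- by move=> x; rewrite lap_pdf_ge0.
- by apply: measurable_funTS; exact: measurable_lap_pdf.
have mpdft : measurable_fun [set x | A (x + t)] (fun x => (lap_pdf b (x + t))%:E).
  apply/measurable_EFinP; apply: measurable_funTS.
  apply: (measurableT_comp (measurable_lap_pdf _ b)).
  exact: (@measurable_funD _ _ _ setT id (cst t)).
rewrite -ge0_integralZl//; last by move=> x _; rewrite lee_fin lap_pdf_ge0.
apply: ge0_le_integral => //.
- by move=> x _; rewrite lee_fin lap_pdf_ge0.
- exact: mpdf.
- exact: measurable_funeM.
- by move=> x _; rewrite -EFinM lee_fin lap_pdf_shift.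
Qed.

Lemma laplace_rv_opp (A : set R) : measurable A ->
  P (Y @^-1` [set x | A (- x)%R]) = P (Y @^-1` A).
Proof.
move=> mA.
have mAN : measurable [set x | A (- x)%R].
  by rewrite -[X in measurable X]setTI; exact: oppr_measurable.
rewrite lapY.2// lapY.2//.
rewrite [RHS](@ge0_lebesgue_integral_opp _ (lap_pdf b) A mA).
- by apply: eq_integral => x _; rewrite /lap_pdf normrN.
- by apply: measurable_funTS; exact: measurable_lap_pdf.
- by move=> x; rewrite lap_pdf_ge0.
Qed.

(** The quantile gives the upper tail by complement; the symmetry of the density carries it to the
    lower tail. *)
Lemma laplace_rv_tails (beta q : R) : is_laplace_quantile b (1 - beta) q ->
  P (Y @^-1` `]q, +oo[) = beta%:E /\ P (Y @^-1` `]-oo, - q[) = beta%:E.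
Proof.
move=> quant; have up : P (Y @^-1` `]q, +oo[) = beta%:E.
  have -> : Y @^-1` `]q, +oo[ = ~` (Y @^-1` [set` `]-oo, q]]).
    by rewrite -setCitvl; exact: preimage_setC.
  rewrite probability_setC; last by apply: laplace_rv_measurable; exact: measurable_itv.
  by rewrite lapY.2// quant -EFinB; congr EFin; lra.
split => //; rewrite -up -(@laplace_rv_opp `]q, +oo[)//; congr (P (_ @^-1` _)).
by apply/seteqP; split => x /=; rewrite !in_itv/= ?andbT; lra.
Qed.

End laplace_rv.

(** * Auxiliary estimates: countable unions, products, limits and half-lines *)

(** Countable additivity turns both sides into series that are compared term by term. It serves for
    grid cells and for outputs. *)
Lemma measure_bigcup_le (R : realType) (d : measure_display)
  (T : measurableType d) (mu : {measure set T -> \bar R}) (I : countType)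
  (D : set I) (F G : I -> set T) (c : R) : 0 <= c ->
  (forall i, measurable (F i)) -> (forall i, measurable (G i)) ->
  trivIset D F -> trivIset D G ->
  (forall i, D i -> mu (F i) <= c%:E * mu (G i))%E ->
  (mu (\bigcup_(i in D) F i) <= c%:E * mu (\bigcup_(i in D) G i))%E.
Proof.
move=> c0 mF mG tF tG FG.
(* The index type is moved to [nat] through [pickle_inv]; numbers that code no index receive the
   empty set. *)
pose E := [set n | exists2 i, pickle_inv n = Some i & D i].
pose enc (H : I -> set T) n := if pickle_inv n is Some i then H i else set0.
have bigcupE H : \bigcup_(i in D) H i = \bigcup_(n in E) enc H n.
  apply/seteqP; split => [w [i Di Hw]|w [n [i ni Di]]].
    exists (pickle i); rewrite /enc ?pickleK_inv//.
    by exists i; rewrite ?pickleK_inv.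
  by rewrite /enc ni => Hw; exists i.
have menc H n : (forall i, measurable (H i)) -> measurable (enc H n).
  by move=> mH; rewrite /enc; case: pickle_inv.
have tenc H : trivIset D H -> trivIset E (enc H).
  move=> tH n m [i ni Di] [j mj Dj]; rewrite /enc ni mj => /(tH _ _ Di Dj) ij.
  have := pickle_invK (T := I) n; have := pickle_invK (T := I) m.
  by rewrite ni mj /= ij => -> ->.
rewrite !bigcupE !measure_bigcup; do ?[exact: tenc | by move=> n _; exact: menc].
rewrite -nneseriesZl//; apply: lee_nneseries => // n /set_mem[i ni Di].
by rewrite /enc ni; exact: FG.
Qed.

(** Nonnegativity is carried through the induction with the comparison, since multiplying
    inequalities in [\bar R] requires it. *)
Lemma lee_prod_seq (R : realType) (I : Type) (s : seq I) (u v : I -> \bar R) :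
  (forall i, 0 <= u i <= v i)%E ->
  (0 <= \prod_(i <- s) u i <= \prod_(i <- s) v i)%E.
Proof.
move=> uv; apply: (big_rec2 (fun x y => 0 <= x <= y)%E) => [|i x y _ /andP[x0 xy]].
  by rewrite lexx lee_fin ler01.
by have /andP[u0 uvi] := uv i; rewrite mule_ge0//= lee_pmul.
Qed.

(** For positive [x] and [y], logarithms turn the factor [expR h] into an additive slack; the cases
    [y = 0] and [x <= 0] are settled directly. *)
Lemma ler_expR_limit (R : realType) (e x y : R) : 0 <= y ->
  (forall h, 0 < h -> x <= expR (e + h) * y) -> x <= expR e * y.
Proof.
rewrite le_eqVlt => /predU1P[<- xh|y0 xh].
  by have := xh 1 ltr01; rewrite !mulr0.
have [x0|x0] := leP x 0; first by rewrite (le_trans x0)// mulr_ge0 ?expR_ge0 ?ltW.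
rewrite -[x]lnK// -[y]lnK// -expRD ler_expR; apply/ler_addgt0Pr => h h0.
by have := xh h h0; rewrite -{1}[x]lnK// -{1}[y]lnK// -expRD ler_expR; lra.
Qed.

(** The first half-line is the second one translated by [a' - a], which lies between [0] and [t]. *)
Lemma laplace_rv_halfline (R : realType) (d : measure_display)
  (T : measurableType d) (P : probability T R) (b : R) (Y : T -> R) (a a' t : R) :
  0 < b -> is_laplace_rv P b Y -> a <= a' <= a + t ->
  (P (Y @^-1` `[a, +oo[) <= (expR (t / b))%:E * P (Y @^-1` `[a', +oo[))%E.
Proof.
move=> b0 lapY /andP[aa' a't].
have -> : Y @^-1` `[a, +oo[ = Y @^-1` [set x | `[a', +oo[%classic (x + (a' - a))].
  by apply/seteqP; split => w /=; rewrite !in_itv/= !andbT; lra.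
have := laplace_rv_shift _ _ _ b0 lapY _ (a' - a) (measurable_itv `[a', +oo[).
move=> /le_trans; apply; apply: lee_wpmul2r => //.
rewrite lee_fin ler_expR ler_pM2r ?invr_gt0// ger0_norm; lra.
Qed.

(** * Noise paths: the threshold test without forced halts *)

Section noise.
Context {R : realType} {d : measure_display} {T : measurableType d}.
Variables (P : probability T R) (Z : T -> R) (nu : nat -> T -> R) (b : R).
Hypotheses (b0 : 0 < b) (lapZ : is_laplace_rv P b Z).
Hypothesis lapnu : forall k, is_laplace_rv P b (nu k).
Hypothesis indep : mutually_independent P
  (fun o : option nat => match o with None => Z | Some k => nu k end).

(** Since the bounds [u i] are constants and not functions of [Z], the event is a rectangle in
    independent coordinates. *)
Lemma noise_box (k : nat) (B V : set R) (u : nat -> R) :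
  measurable B -> measurable V ->
  P [set w | [/\ B (Z w), V (nu k w) & forall i, (i < k)%N -> nu i w < u i]] =
  (P (Z @^-1` B) * (P (nu k @^-1` V) *
    \prod_(i <- iota 0 k) P (nu i @^-1` `]-oo, u i[)))%E.
Proof.
move=> mB mV.
pose J : seq (option nat) := [:: None, Some k & map Some (iota 0 k)].
pose A (o : option nat) : set R := if o is Some i then
  if i == k then V else `]-oo, u i[%classic else B.
have uJ : uniq J.
  rewrite /= inE/= mem_map; last by move=> ? ? [].
  rewrite mem_iota add0n ltnn/= map_inj_uniq ?iota_uniq; last by move=> ? ? [].
  by rewrite andbT; apply/mapP => -[].
have mA i : i \in J -> measurable (A i).
  by move=> _; case: i => [i|]//=; case: ifP.
have := indep J A uJ mA; rewrite -bigcap_seq !big_cons/= eqxx big_map.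
rewrite [in RHS](eq_big_seq (fun i => P (nu i @^-1` `]-oo, u i[))); last first.
  by move=> i; rewrite mem_iota add0n /= => ik; rewrite ifF// ltn_eqF.
move=> <-; congr (P _); apply/seteqP; split => w /=.
  move=> [Bw Vw uw] [i|]//=; rewrite !inE/=.
  have [->//|ik /=] := eqVneq i k.
  rewrite (inj_eq (@Some_inj _)) (negbTE ik) mem_map; last by move=> ? ? [].
  by rewrite mem_iota add0n /= => /uw; rewrite in_itv.
move=> AJ; split.
- exact: (AJ None).
- by have := AJ (Some k); rewrite /= eqxx; apply; rewrite /J !inE eqxx.
- move=> i ik; have := AJ (Some i); rewrite /= ltn_eqF//= in_itv/=; apply.
  by rewrite /J !inE mem_map ?mem_iota ?add0n ?ik ?orbT// => ? ? [].
Qed.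

Lemma measurable_noise_box (k : nat) (B V : set R) (u : nat -> R) :
  measurable B -> measurable V ->
  measurable [set w | [/\ B (Z w), V (nu k w) &
                          forall i, (i < k)%N -> nu i w < u i]].
Proof.
move=> mB mV; rewrite (_ : [set _ | _] = (Z @^-1` B `&` nu k @^-1` V) `&`
    \bigcap_(i in [set i | (i < k)%N]) nu i @^-1` [set` `]-oo, u i[]).
  apply: measurableI.
    by apply: measurableI; [exact: (laplace_rv_measurable _ _ _ lapZ)
                           |exact: (laplace_rv_measurable _ _ _ (lapnu k))].
  apply: bigcap_measurableType => i _.
  by apply: (laplace_rv_measurable _ _ _ (lapnu i)); exact: measurable_itv.
apply/seteqP; split => w /=.
  by move=> [? ? uw]; split => // i /uw /=; rewrite in_itv.
by move=> [[? ?] uw]; split => // i /uw /=; rewrite in_itv.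
Qed.

(** With [stop] true the run halts at query [k]; with [stop] false it has survived the queries
    before [k] and query [k] is left free. One estimate then covers both events. *)
Definition noise_path (c : nat -> R) (k : nat) (stop : bool) : set T :=
  [set w | (forall i, (i < k)%N -> nu i w < Z w + c i) /\
           (stop -> Z w + c k <= nu k w)].

Lemma measurable_noise_lt (i : nat) (c : R) : measurable [set w | nu i w < Z w + c].
Proof.
have mc : measurable_fun setT (fun w => Z w + c).
  by apply: measurable_funD; [exact: lapZ.1 | exact: measurable_cst].
by have := measurable_fun_ltr (lapnu i).1 mc measurableT (Y := [set true]) I; rewrite setTI.
Qed.

Lemma measurable_noise_path (c : nat -> R) (k : nat) (stop : bool) :
  measurable (noise_path c k stop).
Proof.
rewrite (_ : noise_path c k stop =
  (\bigcap_(i in [set i | (i < k)%N]) [set w | nu i w < Z w + c i]) `&`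
  (if stop then ~` [set w | nu k w < Z w + c k] else setT)).
  apply: measurableI.
    by apply: bigcap_measurableType => i _; exact: measurable_noise_lt.
  by case: stop => //; apply: measurableC; exact: measurable_noise_lt.
apply/seteqP; split => w [wk ws]; split => //.
- by case: stop ws => //= /(_ isT); rewrite leNgt => /negP.
- by move=> st; move: ws; rewrite st /= leNgt => /negP.
Qed.

(** Within one cell [Z] is known up to [h], so the path event for [c] can be enlarged, and the one
    for [c'] shrunk, to boxes with constant bounds, where independence applies. *)
Lemma noise_path_le_grid (c c' : nat -> R) (s h : R) (k : nat) (stop : bool) :
  0 < h -> 0 <= s <= 1 -> (forall i, c i <= c' i + s <= c i + 1) ->
  (P (noise_path c k stop) <=
   (expR ((2 + 3 * h) / b))%:E * P (noise_path c' k stop))%E.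
Proof.
move=> h0 s01 cc'.
pose cell (n : int) : set R := `[n%:~R * h, n%:~R * h + h[%classic.
(* The shift by [s] aligns the offsets; the further [h] makes the lower end of the new cell
   compensate for the upper end of the old one. *)
pose cell' (n : int) : set R := `[n%:~R * h + (s + h), n%:~R * h + h + (s + h)[%classic.
pose V (a : R) : set R := if stop then `[a, +oo[%classic else setT.
pose F n := (Z @^-1` cell n) `&` noise_path c k stop.
pose G n := (Z @^-1` cell' n) `&` noise_path c' k stop.
have mV a : measurable (V a) by rewrite /V; case: (stop).
have mcell n : measurable (cell n) by exact: measurable_itv.
have mcell' n : measurable (cell' n) by exact: measurable_itv.
have mF n : measurable (F n).
  apply: measurableI; last exact: measurable_noise_path.
  exact: (laplace_rv_measurable _ _ _ lapZ).
have mG n : measurable (G n).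
  apply: measurableI; last exact: measurable_noise_path.
  exact: (laplace_rv_measurable _ _ _ lapZ).
have cell_inj (n m : int) (x : R) : cell n x -> cell m x -> n = m.
  rewrite /cell /= !in_itv/= => /andP[nx xn] /andP[mx xm].
  have nm : (n < m + 1)%R.
    by rewrite -(ltr_int R) -(ltr_pM2r h0) intrD mulrDl mul1r; lra.
  have mn : (m < n + 1)%R.
    by rewrite -(ltr_int R) -(ltr_pM2r h0) intrD mulrDl mul1r; lra.
  by lia.
have cell'E n x : cell' n x = cell n (x - (s + h)).
  by rewrite /cell' /cell /= !in_itv/=; congr (is_true (_ && _)); lra.
have FE : noise_path c k stop = \bigcup_n F n.
  apply/seteqP; split => [w pw|w [n _ []]//].
  exists (Num.floor (Z w / h)) => //; split => //; rewrite /cell /= in_itv/=.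
  have /andP[lo up] := floor_itv (Z w / h).
  rewrite -ler_pdivlMr// lo/= -{3}[h]mul1r -mulrDl -ltr_pdivrMr//.
  by move: up; rewrite intrD.
have tF : trivIset setT F.
  by move=> n m _ _ [w [[nw _] [mw _]]]; exact: cell_inj nw mw.
have tG : trivIset setT G.
  move=> n m _ _ [w [[nw _] [mw _]]].
  by apply: (cell_inj n m (Z w - (s + h))); rewrite -cell'E.
have FG n : (P (F n) <= (expR ((2 + 3 * h) / b))%:E * P (G n))%E.
  pose a := n%:~R * h.
  pose box := [set w | [/\ cell n (Z w), V (a + c k) (nu k w) &
    forall i, (i < k)%N -> nu i w < a + h + c i]].
  pose box' := [set w | [/\ cell' n (Z w), V (a + h + (s + h) + c' k) (nu k w) &
    forall i, (i < k)%N -> nu i w < a + (s + h) + c' i]].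
  (* To enlarge, survival uses the upper end of the cell and halting the lower end; [box'] uses the
     opposite ends. *)
  have Fbox : F n `<=` box.
    move=> w [zw [pw sw]]; split => //.
      move: zw; rewrite /V /cell /= in_itv/= -/a; case: (stop) sw => //= /(_ isT).
      by rewrite in_itv/=; lra.
    move=> i ik; move: zw (pw i ik); rewrite /cell /= in_itv/= -/a; lra.
  have box'G : box' `<=` G n.
    move=> w [zw vw uw]; split => //; split => [i ik|st].
      by move: zw (uw i ik); rewrite /cell' /= in_itv/= -/a; lra.
    move: zw vw; rewrite /V st /cell' /= !in_itv/= -/a; lra.
  apply: (@le_trans _ _ (P box)).
    by apply: le_measure => //; rewrite inE; do ?exact: measurable_noise_box.
  apply: (@le_trans _ _ ((expR ((2 + 3 * h) / b))%:E * P box')%E); last first.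
    apply: lee_wpmul2l; first by rewrite lee_fin expR_ge0.
    by apply: le_measure => //; rewrite inE; do ?exact: measurable_noise_box.
  rewrite /box /box' !noise_box//.
  (* The cell moves by [s + h <= 1 + h]. The halting bound rises by
     [2 h + (c' k + s - c k) <= 1 + 2 h]. *)
  have -> : (2 + 3 * h) / b = (1 + h) / b + (1 + 2 * h) / b by lra.
  rewrite expRD EFinM -muleA [((expR ((1 + 2 * h) / b))%:E * _)%E]muleCA.
  rewrite muleA [((expR ((1 + 2 * h) / b))%:E * _)%E]muleA.
  apply: lee_pmul => //.
  - by rewrite mule_ge0// prode_ge0.
  - have -> : Z @^-1` cell n = Z @^-1` [set x | cell' n (x + (s + h))].
      by apply/seteqP; split => w /=; rewrite cell'E addrK.
    apply: (le_trans (laplace_rv_shift _ _ _ b0 lapZ _ (s + h) _)) => //.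
    apply: lee_wpmul2r => //.
    by rewrite lee_fin ler_expR ler_pM2r ?invr_gt0// ger0_norm; lra.
  apply: lee_pmul => //.
  - by rewrite prode_ge0.
  - rewrite /V; case: (stop).
      apply: laplace_rv_halfline => //.
      by have := cc' k; lra.
    rewrite preimage_setT probability_setT mule1 lee_fin -[leLHS]expR0 ler_expR.
    by apply: divr_ge0; [lra|exact: ltW].
  (* By [c i <= c' i + s] the survival bounds only grow, so these factors cost nothing, however many
     they are. *)
  apply: (proj2 (andP (lee_prod_seq _ _ _ _ _ _))).
  move=> i; rewrite measure_ge0/=; apply: le_measure; rewrite ?inE//.
  - by apply: (laplace_rv_measurable _ _ _ (lapnu i)); exact: measurable_itv.
  - by apply: (laplace_rv_measurable _ _ _ (lapnu i)); exact: measurable_itv.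
  - by move=> w /=; rewrite !in_itv/=; have := cc' i; lra.
rewrite FE; apply: (@le_trans _ _ ((expR ((2 + 3 * h) / b))%:E * P (\bigcup_n G n))%E).
  by apply: measure_bigcup_le => //; move=> n _; exact: FG.
apply: lee_wpmul2l; first by rewrite lee_fin expR_ge0.
apply: le_measure; rewrite ?inE//.
- exact: countable_bigcupT_measurable.
- exact: measurable_noise_path.
- by move=> w [n _ []].
Qed.

Lemma noise_path_le (c c' : nat -> R) (s : R) (k : nat) (stop : bool) :
  0 <= s <= 1 -> (forall i, c i <= c' i + s <= c i + 1) ->
  (P (noise_path c k stop) <= (expR (2 / b))%:E * P (noise_path c' k stop))%E.
Proof.
move=> s01 cc'; have fin c0 : P (noise_path c0 k stop) \is a fin_num.
  by apply: fin_num_measure; exact: measurable_noise_path.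
rewrite -(fineK (fin c)) -(fineK (fin c')) -EFinM lee_fin.
apply: ler_expR_limit => [|h h0]; first by rewrite fine_ge0.
(* This mesh makes the exponent of the grid estimate exactly [2 / b + h]. *)
have h'0 : 0 < h * b / 3 by rewrite divr_gt0// mulr_gt0.
have := noise_path_le_grid _ _ s _ k stop h'0 s01 cc'.
rewrite -(fineK (fin c)) -(fineK (fin c')) -EFinM lee_fin.
have -> // : (2 + 3 * (h * b / 3)) / b = 2 / b + h.
by have := lt0r_neq0 b0 => bn0; field.
Qed.

Definition noise_path_inf (c : nat -> R) : set T :=
  [set w | forall i, nu i w < Z w + c i].

Lemma noise_path_infE (c : nat -> R) :
  noise_path_inf c = \bigcap_k noise_path c k false.
Proof.
apply/seteqP; split => w /= pw; first by move=> k _; split => // i _; exact: pw.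
by move=> i; have [] := pw i.+1 I; move=> /(_ i (ltnSn i)).
Qed.

Lemma measurable_noise_path_inf (c : nat -> R) : measurable (noise_path_inf c).
Proof.
rewrite noise_path_infE.
by apply: bigcapT_measurable => k; exact: measurable_noise_path.
Qed.

(** Never halting is the decreasing intersection of the finite survival events. It lies in each of
    those for [c], and continuity from above passes to the limit on the side of [c']. *)
Lemma noise_path_inf_le (c c' : nat -> R) (s : R) :
  0 <= s <= 1 -> (forall i, c i <= c' i + s <= c i + 1) ->
  (P (noise_path_inf c) <= (expR (2 / b))%:E * P (noise_path_inf c'))%E.
Proof.
move=> s01 cc'.
have lim : (P \o (fun k => noise_path c' k false)) @ \oo --> P (noise_path_inf c').
  rewrite noise_path_infE; apply: nonincreasing_cvg_mu.
  - exact: le_lt_trans (probability_le1 _ (measurable_noise_path _ _ _)) (ltry _).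
  - by move=> i; exact: measurable_noise_path.
  - by rewrite -noise_path_infE; exact: measurable_noise_path_inf.
  - move=> n m nm; apply/subsetPset => w [pw _]; split => // i im.
    exact/pw/(leq_trans im).
apply: (cvge_ge _ (cvgeZl _ lim)) => //; near=> k.
apply: le_trans (noise_path_le _ c' s k false s01 cc').
apply: le_measure; rewrite ?inE.
- exact: measurable_noise_path_inf.
- exact: measurable_noise_path.
- by move=> w pw; split => // i _; exact: pw.
Unshelve. all: by end_near. Qed.

(** Surviving query [k], which is why the index is [k.+1], gives [nu k < Z - 2 q]; hence [Z > q] or
    [nu k < - q], and a union bound adds the two tails. *)
Lemma noise_path_overshoot (c : nat -> R) (k : nat) (beta q : R) :
  is_laplace_quantile b (1 - beta) q -> c k <= - 2 * q ->
  (P (noise_path c k.+1 false) <= (2 * beta)%:E)%E.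
Proof.
move=> quant ck.
have [upZ _] := laplace_rv_tails _ _ _ b0 lapZ _ _ quant.
have [_ lonu] := laplace_rv_tails _ _ _ b0 (lapnu k) _ _ quant.
have mZ : measurable (Z @^-1` `]q, +oo[).
  by apply: (laplace_rv_measurable _ _ _ lapZ); exact: measurable_itv.
have mnu : measurable (nu k @^-1` `]-oo, - q[).
  by apply: (laplace_rv_measurable _ _ _ (lapnu k)); exact: measurable_itv.
apply: (@le_trans _ _ (P (Z @^-1` `]q, +oo[ `|` nu k @^-1` `]-oo, - q[))).
  apply: le_measure; rewrite ?inE//; first exact: measurable_noise_path.
    exact: measurableU.
  move=> w [/(_ k (ltnSn k)) kw _] /=; rewrite !in_itv/= andbT.
  by have [zq|] := leP (Z w) q; [right; lra | left].
apply: (@le_trans _ _ (P (Z @^-1` `]q, +oo[) + P (nu k @^-1` `]-oo, (- q)%R[))%E).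
  exact: measureU2.
by rewrite upZ lonu -EFinD lee_fin; lra.
Qed.

End noise.

(** * From noise paths to the outputs of the mechanism *)

Section mechanism.
Context {R : realType} {X : Type} {d : measure_display} {T : measurableType d}.
Variables (P : probability T R) (eps delta Thr q : R) (f : nat -> seq X -> R).
Variables (Z : T -> R) (nu : nat -> T -> R).
Hypotheses (eps0 : 0 < eps) (delta0 : 0 < delta).
Hypothesis quant :
  is_laplace_quantile (2 / eps) (1 - delta / (2 * (1 + expR eps))) q.
Hypothesis lapZ : is_laplace_rv P (2 / eps) Z.
Hypothesis lapnu : forall k, is_laplace_rv P (2 / eps) (nu k).
Hypothesis indep : mutually_independent P
  (fun o : option nat => match o with None => Z | Some k => nu k end).

Local Notation out := (sudsat_output f Thr q Z nu).
Local Notation stops := (sudsat_stops f Thr q Z nu).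

Definition offset (D : seq X) (i : nat) : R := Thr - 2 * q - f i D.

(* The outputs of the variant of the algorithm without the forced halting
   test [f_i(D) >= T]. *)
Definition unforced (D : seq X) (o : option nat) : set T :=
  if o is Some k then noise_path Z nu (offset D) k true
  else noise_path_inf Z nu (offset D).

Let b0 : 0 < 2 / eps.
Proof. by rewrite divr_gt0. Qed.

(** Two unit translations at scale [2 / eps] cost exactly [expR eps]. *)
Let twodivb : 2 / (2 / eps) = eps.
Proof. by rewrite invf_div mulrCA divff ?mulr1. Qed.

Lemma sudsat_outputP (D : seq X) (w : T) (o : option nat) :
  out D w = o <->
  (if o is Some k then stops D w k /\ (forall i, (i < k)%N -> ~~ stops D w i)
   else forall i, ~~ stops D w i).
Proof.
rewrite /sudsat_output; case: pselect => [ex|nex]; last first.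
  case: o => [k|]; split => //; first by move=> [sk _]; case: nex; exists k.
  by move=> _ i; apply/negP => si; apply: nex; exists i.
case: ex_minnP => m sm minm; case: o => [k|]; split => //.
- move=> [<-]; split => // i im; apply/negP => /minm.
  by rewrite leqNgt im.
- move=> [sk mink]; congr Some; apply/eqP; rewrite eqn_leq minm//=.
  by rewrite leqNgt; apply/negP => /mink; rewrite sm.
- by move=> /(_ m); rewrite sm.
Qed.

Lemma sudsat_stopsE (D : seq X) (w : T) (k : nat) :
  stops D w k = (Thr <= f k D) || (Z w + offset D k <= nu k w).
Proof.
rewrite /sudsat_stops /offset; apply/asboolP/orP.
  by case=> ?; [left | right; lra].
by case=> ?; [left | right; lra].
Qed.

Lemma measurable_sudsat_stops (D : seq X) (k : nat) :
  measurable [set w | stops D w k].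
Proof.
rewrite (_ : [set _ | _] = if Thr <= f k D then setT
  else ~` [set w | nu k w < Z w + offset D k]).
  by case: ifP => // _; apply: measurableC; exact: (measurable_noise_lt _ _ _ _ lapZ lapnu).
apply/seteqP; split => w /=; rewrite sudsat_stopsE; case: ifP => //= _.
  by rewrite leNgt => /negP.
by move/negP; rewrite -leNgt.
Qed.

(** As [option nat] is countable, an arbitrary [S] splits into countably many singletons, whose
    events are intersections of stopping tests and their complements. *)
Lemma measurable_sudsat_output (D : seq X) (S : set (option nat)) :
  measurable (out D @^-1` S).
Proof.
rewrite (_ : _ @^-1` _ = \bigcup_o (out D @^-1` (S `&` [set o]))); last first.
  apply/seteqP; split => [w Sw|w [x _ []]//].
  by exists (out D w) => //; split.
apply: countable_bigcupT_measurable; first exact: countableP.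
move=> o; have [So|nSo] := pselect (S o); last first.
  by rewrite (_ : _ @^-1` _ = set0)// -subset0 => w /= [Sw wo]; apply: nSo; rewrite -wo.
have mN i : measurable [set w | ~~ stops D w i].
  rewrite (_ : [set _ | _] = ~` [set w | stops D w i]).
    by apply: measurableC; exact: measurable_sudsat_stops.
  by apply/seteqP; split => w /= /negP.
case: o So => [k|] So.
  rewrite (_ : _ @^-1` _ = [set w | stops D w k] `&`
      \bigcap_(i in [set i | (i < k)%N]) [set w | ~~ stops D w i]).
    apply: measurableI; first exact: measurable_sudsat_stops.
    by apply: bigcap_measurableType => i _; exact: mN.
  apply/seteqP; split => w /=; first by move=> [_ /sudsat_outputP].
  by move=> wk; rewrite (proj2 (sudsat_outputP D w (Some k)) wk).
rewrite (_ : _ @^-1` _ = \bigcap_i [set w | ~~ stops D w i]).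
  by apply: bigcapT_measurable => i; exact: mN.
apply/seteqP; split => w /=; first by move=> [_ /sudsat_outputP wi] i _; exact: wi.
by move=> wi; have -> : out D w = None by apply/sudsat_outputP => i; exact: wi.
Qed.

Lemma measurable_unforced (D : seq X) (o : option nat) :
  measurable (unforced D o).
Proof.
case: o => [k|]; first exact: (measurable_noise_path _ _ _ _ lapZ lapnu).
exact: (measurable_noise_path_inf _ _ _ _ lapZ lapnu).
Qed.

(** At most one index is the first to pass the noisy test. Disjointness lets the bounds for single
    outputs be summed over a set of outputs. *)
Lemma unforced_trivIset (D : seq X) (I : set (option nat)) :
  trivIset I (unforced D).
Proof.
move=> o o' _ _ [w [ow ow']]; move: o o' ow ow' => [k|] [l|]//=.
- move=> [wk /(_ isT) sk] [wl /(_ isT) sl].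
  have [kl|lk|->//] := ltngtP k l.
    by have := wl _ kl; rewrite ltNge sk.
  by have := wk _ lk; rewrite ltNge sl.
- by move=> [_ /(_ isT)]; rewrite leNgt => /negP nk /(_ k).
- by move=> /(_ l) lw [_ /(_ isT)]; rewrite leNgt lw.
Qed.

(** Only queries before [k] must lie below [Thr]: at [k] itself a forced halt and a noisy halt give
    the same output. *)
Lemma unforced_output_Some (D : seq X) (k : nat) (w : T) :
  (forall i, (i < k)%N -> f i D < Thr) -> unforced D (Some k) w ->
  out D w = Some k.
Proof.
move=> fk [wk /(_ isT) sk]; apply/sudsat_outputP; rewrite sudsat_stopsE sk orbT.
by split => // i ik; rewrite sudsat_stopsE negb_or -!ltNge fk//= wk.
Qed.

Lemma unforced_output (D : seq X) (o : option nat) (w : T) :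
  (forall i, f i D < Thr) -> unforced D o w -> out D w = o.
Proof.
case: o => [k|] fT; first exact: unforced_output_Some.
by move=> ow; apply/sudsat_outputP => i; rewrite sudsat_stopsE negb_or -!ltNge fT/=.
Qed.

Lemma unforced_before (D : seq X) (n : nat) (w : T) :
  ~ noise_path Z nu (offset D) n false w ->
  exists2 k, (k < n)%N & unforced D (Some k) w.
Proof.
move=> nw.
have ex : exists i, (i < n)%N && (Z w + offset D i <= nu i w).
  apply: contrapT => nex; apply: nw; split => // i ik.
  by rewrite ltNge; apply/negP => iw; apply: nex; exists i; rewrite ik.
case: (ex_minnP ex) => k /andP[kn kw] mink; exists k => //; split => // i ik.
rewrite ltNge; apply/negP => iw.
by have := mink i; rewrite (ltn_trans ik kn) iw leqNgt ik => /(_ isT).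
Qed.

Lemma unforced_le (D D' : seq X) (s : R) (o : option nat) : 0 <= s <= 1 ->
  (forall i, offset D i <= offset D' i + s <= offset D i + 1) ->
  (P (unforced D o) <= (expR eps)%:E * P (unforced D' o))%E.
Proof.
move=> s01 DD'; rewrite -twodivb; case: o => [k|].
  exact: (noise_path_le _ _ _ _ b0 lapZ lapnu indep _ _ s).
exact: (noise_path_inf_le _ _ _ _ b0 lapZ lapnu indep _ _ s).
Qed.

Lemma noise_path_forced_le (D D' : seq X) (s : R) (K : nat) : 0 <= s <= 1 ->
  (forall i, offset D i <= offset D' i + s <= offset D i + 1) ->
  (Thr <= f K D) || (Thr <= f K D') ->
  (P (noise_path Z nu (offset D) K.+1 false) <= delta%:E)%E.
Proof.
move=> s01 DD' forced; pose beta := delta / (2 * (1 + expR eps)).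
have e0 := expR_gt0 eps.
(* This identity bounds by [delta] both [2 beta], when [D] reaches [Thr], and [expR eps * 2 beta],
   when the bound is transferred from [D']. *)
have betaE : 2 * beta * (1 + expR eps) = delta by rewrite /beta; field; lra.
have beta0 : 0 < beta by rewrite divr_gt0//; lra.
case/orP: forced => forced.
  apply: (@le_trans _ _ (2 * beta)%:E); last by rewrite lee_fin; nra.
  apply: (noise_path_overshoot _ _ _ _ b0 lapZ lapnu _ _ _ _ quant).
  by rewrite /offset; lra.
apply: (@le_trans _ _ ((expR eps)%:E * (2 * beta)%:E)%E); last first.
  by rewrite -EFinM lee_fin; nra.
apply: (@le_trans _ _ ((expR eps)%:E *
    P (noise_path Z nu (offset D') K.+1 false))%E).
  by rewrite -[in expR eps]twodivb; exact: (noise_path_le _ _ _ _ b0 lapZ lapnu indep _ _ s).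
apply: lee_wpmul2l; first by rewrite lee_fin ltW.
apply: (noise_path_overshoot _ _ _ _ b0 lapZ lapnu _ _ _ _ quant).
by rewrite /offset; lra.
Qed.

(** The algorithm is compared with its unforced variant: up to the first forced index [K] if there
    is one, and for all outputs otherwise. *)
Lemma sudsat_output_le (D D' : seq X) (s : R) (S : set (option nat)) :
  0 <= s <= 1 ->
  (forall i, offset D i <= offset D' i + s <= offset D i + 1) ->
  (P (out D @^-1` S) <= (expR eps)%:E * P (out D' @^-1` S) + delta%:E)%E.
Proof.
move=> s01 DD'; have e0 := expR_ge0 eps.
have mU D0 (I : set (option nat)) : measurable (\bigcup_(o in I) unforced D0 o).
  rewrite bigcup_mkcond; apply: countable_bigcupT_measurable => [|o].
    exact: countableP.
  by case: ifP => // _; exact: measurable_unforced.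
have U_le (I : set (option nat)) : (P (\bigcup_(o in I) unforced D o) <=
    (expR eps)%:E * P (\bigcup_(o in I) unforced D' o))%E.
  apply: measure_bigcup_le => //; do ?exact: measurable_unforced.
  - exact: unforced_trivIset.
  - exact: unforced_trivIset.
  - by move=> o _; exact: unforced_le s01 DD'.
have [ex|nex] := pselect (exists k, (Thr <= f k D) || (Thr <= f k D')).
  case: (ex_minnP ex) => K forced minK.
  have lt_f i : (i < K)%N -> f i D < Thr /\ f i D' < Thr.
    move=> iK; rewrite !ltNge; split; apply/negP => fi;
      by have := minK i; rewrite fi ?orbT leqNgt iK => /(_ isT).
  (* Noisy halts up to [K] are matched output by output. All other runs, including those halted at
     [K] by force alone, survive [K] in the unforced variant and are charged to [delta]. *)
  pose I := [set o | S o /\ exists2 k, (k < K.+1)%N & o = Some k].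
  have mK := measurable_noise_path _ _ _ _ lapZ lapnu (offset D) K.+1 false.
  apply: (@le_trans _ _ (P ((\bigcup_(o in I) unforced D o) `|`
      noise_path Z nu (offset D) K.+1 false))).
    apply: le_measure; rewrite ?inE; first exact: measurable_sudsat_output.
      exact: measurableU.
    move=> w /= Sw; have [|/unforced_before[k kK kw]] :=
      pselect (noise_path Z nu (offset D) K.+1 false w); first by right.
    left; exists (Some k) => //; split; last by exists k.
    rewrite -(unforced_output_Some D k w)// => i ik.
    by apply: (proj1 (lt_f i _)); exact: leq_trans ik kK.
  apply: (@le_trans _ _ (P (\bigcup_(o in I) unforced D o) +
      P (noise_path Z nu (offset D) K.+1 false))%E); first exact: measureU2.
  apply: leeD; last exact: noise_path_forced_le s01 DD' forced.
  apply: (le_trans (U_le I)); apply: lee_wpmul2l; first by rewrite lee_fin.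
  apply: le_measure; rewrite ?inE//; first exact: measurable_sudsat_output.
  move=> w [x [Sx [k kK xk]]]; rewrite xk in Sx * => kw /=.
  rewrite (unforced_output_Some D' k w)// => i ik.
  by apply: (proj2 (lt_f i _)); exact: leq_trans ik kK.
(* With no forced halt on either dataset, the variant and the algorithm have the same outputs,
   [None] included. *)
have fD i : f i D < Thr by rewrite ltNge; apply/negP => fi; apply: nex; exists i; rewrite fi.
have fD' i : f i D' < Thr.
  by rewrite ltNge; apply/negP => fi; apply: nex; exists i; rewrite fi orbT.
apply: (@le_trans _ _ ((expR eps)%:E * P (out D' @^-1` S))%E); last first.
  by rewrite leeDl// lee_fin ltW.
apply: (@le_trans _ _ (P (\bigcup_(o in S) unforced D o))).
  apply: le_measure; rewrite ?inE//; first exact: measurable_sudsat_output.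
  move=> w /= Sw.
  have [x xw] : exists x, unforced D x w.
    have [inf|ninf] := pselect (noise_path_inf Z nu (offset D) w); first by exists None.
    have [i iw] : exists i, ~ nu i w < Z w + offset D i by apply/existsNP.
    have [|k _ kw] := @unforced_before D i.+1 w; last by exists (Some k).
    by move=> [/(_ i (ltnSn i))].
  by exists x => //; rewrite -(unforced_output D x w).
apply: (le_trans (U_le S)); apply: lee_wpmul2l; first by rewrite lee_fin.
apply: le_measure; rewrite ?inE//; first exact: measurable_sudsat_output.
by move=> w [x Sx xw] /=; rewrite (unforced_output D' x w).
Qed.

End mechanism.

Theorem theorem4p2 (R : realType) (X : Type) (eps delta Thr : R)
  (f : nat -> seq X -> R)
  (d : measure_display) (T : measurableType d) (P : probability T R)
  (Z : T -> R) (nu : nat -> T -> R) (q : R) :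
  0 < eps -> 0 < delta < 1 ->
  (forall i (D D' : seq X), neighboring D D' -> `|f i D - f i D'| <= 1) ->
  (forall D D' : seq X, neighboring D D' ->
     (exists i, f i D' < f i D) -> ~ (exists j, f j D < f j D')) ->
  is_laplace_quantile (2 / eps) (1 - delta / (2 * (1 + expR eps))) q ->
  is_laplace_rv P (2 / eps) Z ->
  (forall k, is_laplace_rv P (2 / eps) (nu k)) ->
  mutually_independent P (fun o : option nat =>
                            match o with None => Z | Some k => nu k end) ->
  diff_private P (sudsat_output f Thr q Z nu) eps delta.
Proof.
move=> eps0 /andP[delta0 _] sens uds quant lapZ lapnu indep D D' DD' S.
have fD i : f i D - f i D' <= 1 /\ f i D' - f i D <= 1.
  by have := sens i D D' DD'; rewrite ler_norml; lra.
have le_out := sudsat_output_le P eps delta Thr q f Z nu eps0 delta0 quant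
  lapZ lapnu indep.
(* Unidirectional sensitivity gives all the differences [f i D - f i D'] the same sign. *)
have [gtD|/forallNP leD] := pselect (exists i, f i D' < f i D).
  have /forallNP geD := uds D D' DD' gtD.
  have {}geD i : f i D' <= f i D by rewrite leNgt; apply/negP/geD.
  (* Larger query values mean smaller offsets: from [D] to [D'] the offsets already increase, so
     [s = 0]; in the reverse direction [s = 1] makes up for a decrease of at most [1]. *)
  split; [apply: (le_out D D' 0) | apply: (le_out D' D 1)]; do ?lra;
    by move=> i; rewrite /offset; have := geD i; have := fD i; lra.
have {}leD i : f i D <= f i D' by rewrite leNgt; apply/negP/leD.
split; [apply: (le_out D D' 1) | apply: (le_out D' D 0)]; do ?lra;
  by move=> i; rewrite /offset; have := leD i; have := fD i; lra.
Qed.
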